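(* Let $g\in G^5$ with $\upsilon(g)\geq 2$ and let $u,v\in G^+$. Then: (i) $\beta(g)=\beta(g^cg^Lg)=\beta(gg^Rg^c)$ and $\beta\big(g^rg^{ra}g^c(g^{la})'g^l\big)=\beta\big(g^rg^{ra}g(g^{la})'g^l\big)$. (ii) $\beta(u)=\beta(v)$ if and only if $[u]=[v]$.
   Context: **The set $G$.** Let $A=\{1,x,x'\}$ (three distinct symbols) with involution $'$ exchanging $x$ and $x'$ and fixing $1$. A 5-tuple is written $g=(g^{l},g^{la},g^{c},g^{ra},g^{r})$. Put $g_{xx'}=(1,1,x,x',1)$, $G_{1,e}=\{g_{xx'}\}$ and, for $i\ge 2$, $G_{i,e}=\{(g,(g^{la})',g^l,(g^{ra})',g),\ (g,(g^{ra})',g^l,(g^{la})',g) : g\in G_{i-1,e}\}$. Put $G_{1,d}=G_{2,d}=\emptyset$ and $G_i=G_{i,e}\cup G_{i,d}$, where recursively for $i\ge 3$, $G_{i,d}$ is the set of all $g\in G_{i-1}\times A\times G_{i-2}\times A\times G_{i-1}$ such that: (1) $g^l\neq g^r$; (2) $(g^c,g^{la})$ equals $((g^l)^l,((g^l)^{la})')$ or $((g^l)^r,((g^l)^{ra})')$; (3) $(g^c,g^{ra})$ equals $((g^r)^l,((g^r)^{la})')$ or $((g^r)^r,((g^r)^{ra})')$. Let $G^5=\bigcup_{i\ge1}G_i$, $G'=G^5\cup\{1\}$, $G=G^5\cup A$. The height is $\upsilon(1)=0$ and $\upsilon(g)=i$ for $g\in G_i$. **The congruence $\rho$.** For $g\in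 G^5$ with $\upsilon(g)\ge2$ let $g^L=(g^{la})'g^lg^{la}$ and $g^R=(g^{ra})'g^rg^{ra}$, words in the free semigroup $G^+$. Let $\rho$ be the smallest congruence on $G^+$ containing the pairs $(xx'x,x)$, $(x'xx',x')$, $(g_{xx'},xx')$; the pairs $(1g,g)$, $(g1,g)$ for $g\in G$; the pairs $(g^2,g)$ for $g\in G'$; and, for every $g\in G^5$ with $\upsilon(g)\ge 2$, the pairs $(g^cg^Lg,g)$, $(gg^Rg^c,g)$ and $(g^rg^{ra}g(g^{la})'g^l,\ g^rg^{ra}g^c(g^{la})'g^l)$. Write $[u]$ for the $\rho$-class of $u$. **Landscapes.** For $g_1\in G'$, $g\in G^5$, $a\in A$: $g_1ag$ is left anchored if $(g_1,a)\in\{(g^l,g^{la}),(g^r,g^{ra})\}$; $gag_1$ is right anchored if $(g_1,a)\in\{(g^l,(g^{la})'),(g^r,(g^{ra})')\}$. A landscape is a word $u=g_0a_1g_1\cdots a_ng_n$ ($n\ge0$, $g_j\in G'$, $a_j\in A$) in which every $g_{i-1}a_ig_i$ is left anchored or right anchored. If $u_1$ ends with the letter with which $u_2$ begins, $u_1*u_2$ is obtained from $u_1u_2$ by replacing the doubled letter at the junction by a single one. A river of $u$ is a letter $g_i$ ($0<i<n$) with $\upsilon(g_{i-1})=\upsilon(g_{i+1})=\upsilon(g_i)+1$. A mountain range is a landscape with $g_0=g_n=1$; a mountain is a mountain range without rivers. **Uplifting of rivers.** Let $g_i$ be a river of the landscape $u$ and $h_i=(g_{i+1},a_{i+1}',g_i,a_i,g_{i-1})$.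 If $g_{i-1}=g_{i+1}$ and $a_i=a_{i+1}'$, let $v$ be obtained from $u$ by deleting the factor $a_ig_ia_{i+1}g_{i+1}$ (so $v=g_0a_1\cdots g_{i-1}a_{i+2}g_{i+2}\cdots g_n$); otherwise $h_i\in G^5$ and $v$ is obtained from $u$ by replacing $g_i$ by $h_i$. Then $v$ is a landscape and we write $u\to v$; $\xrightarrow{*}$ is the reflexive transitive closure. For each landscape $u$ there is exactly one landscape $\beta_2(u)$ without rivers such that $u\xrightarrow{*}\beta_2(u)$. **The map $\beta$.** Put $\lambda_l(1)=\lambda_r(1)=1$, $\lambda_l(g_{xx'})=1\,1\,g_{xx'}$, $\lambda_r(g_{xx'})=g_{xx'}\,1\,1$, and for $g\in G^5$ with $\upsilon(g)\ge2$: $\lambda_l(g)=\lambda_l(g^c)\,(g^{la})'\,g^l\,g^{la}\,g$ and $\lambda_r(g)=g\,(g^{ra})'\,g^r\,g^{ra}\,\lambda_r(g^c)$. Put $\beta_1(g)=\lambda_l(g)*\lambda_r(g)$ for $g\in G'$ (so $\beta_1(1)=1$), $\beta_1(x)=1\,1\,g_{xx'}\,x\,1$, $\beta_1(x')=1\,x'\,g_{xx'}\,1\,1$, and $\beta_1(h_0\cdots h_k)=\beta_1(h_0)*\cdots*\beta_1(h_k)$ for $h_0,\dots,h_k\in G$; this is a mountain range. For $u\in G^+$ put $\beta(u)=\beta_2(\beta_1(u))$, which is a mountain. *)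

(* Defs.v *)
From Stdlib Require Import Relation_Operators ClassicalEpsilon.
From mathcomp Require Import all_boot.

Set Implicit Arguments.
Unset Strict Implicit.
Unset Printing Implicit Defensive.

(* A = {1, x, x'}. *)
Inductive A : Type := A1 | Ax | Ax'.

Definition ainv (a : A) : A :=
  match a with A1 => A1 | Ax => Ax' | Ax' => Ax end.

(* Ambient type of all symbols: atoms from A and nested 5-tuples           *)
(* (g^l, g^la, g^c, g^ra, g^r); the sets G_i, G^5, G', G are carved out of *)
(* it by predicates.                                                       *)
Inductive symbol : Type :=
  | Atom (a : A)
  | Tup (l : symbol) (la : A) (c : symbol) (ra : A) (r : symbol).

Coercion Atom : A >-> symbol.

Definition word := seq symbol.

(* The values of the projections on atoms are irrelevant. *)
Definition gl (g : symbol) : symbol := if g is Tup l _ _ _ _ then l else g.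
Definition gla (g : symbol) : A := if g is Tup _ la _ _ _ then la else A1.
Definition gc (g : symbol) : symbol := if g is Tup _ _ c _ _ then c else g.
Definition gra (g : symbol) : A := if g is Tup _ _ _ ra _ then ra else A1.
Definition gr (g : symbol) : symbol := if g is Tup _ _ _ _ r then r else g.

Definition gxx' : symbol := Tup A1 A1 Ax Ax' A1.

(* G_{i,e}; empty for i = 0. *)
Inductive inGe : nat -> symbol -> Prop :=
  | inGe_1 : inGe 1 gxx'
  | inGe_Sl i g : inGe i g ->
      inGe i.+1 (Tup g (ainv (gla g)) (gl g) (ainv (gra g)) g)
  | inGe_Sr i g : inGe i g ->
      inGe i.+1 (Tup g (ainv (gra g)) (gl g) (ainv (gla g)) g).

(* G_i = G_{i,e} \cup G_{i,d}; the second constructor is G_{i,d}, which is *)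
(* empty for i < 3.                                                        *)
Inductive inGi : nat -> symbol -> Prop :=
  | inGi_e i g : inGe i g -> inGi i g
  | inGi_d i l la c ra r :
      inGi i.+2 l -> inGi i.+1 c -> inGi i.+2 r ->
      l <> r ->
      (c, la) = (gl l, ainv (gla l)) \/ (c, la) = (gr l, ainv (gra l)) ->
      (c, ra) = (gl r, ainv (gla r)) \/ (c, ra) = (gr r, ainv (gra r)) ->
      inGi i.+3 (Tup l la c ra r).

Definition G5 (g : symbol) : Prop := exists2 i, 1 <= i & inGi i g.
Definition G' (g : symbol) : Prop := G5 g \/ g = A1.
Definition G (g : symbol) : Prop := G5 g \/ exists a : A, g = a.

(* upsilon; [heightE] shows that it takes the value i on G_i. *)
Fixpoint height (g : symbol) : nat :=
  if g is Tup l _ _ _ _ then (height l).+1 else 0.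

Lemma heightE i g : inGi i g -> height g = i.
Proof.
have eE j h : inGe j h -> height h = j.
  by elim=> [//|k h' _ /= ->|k h' _ /= ->].
by elim=> [j h /eE //|j l la c ra r _ /= -> //].
Qed.

Definition Gplus (u : word) : Prop := u <> [::] /\ List.Forall G u.

Definition gL (g : symbol) : word :=
  [:: Atom (ainv (gla g)); gl g; Atom (gla g)].
Definition gR (g : symbol) : word :=
  [:: Atom (ainv (gra g)); gr g; Atom (gra g)].

Inductive rho_pair : word -> word -> Prop :=
  | pair_x : rho_pair [:: Atom Ax; Atom Ax'; Atom Ax] [:: Atom Ax]
  | pair_x' : rho_pair [:: Atom Ax'; Atom Ax; Atom Ax'] [:: Atom Ax']
  | pair_gxx' : rho_pair [:: gxx'] [:: Atom Ax; Atom Ax']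
  | pair_1l g : G g -> rho_pair [:: Atom A1; g] [:: g]
  | pair_1r g : G g -> rho_pair [:: g; Atom A1] [:: g]
  | pair_idem g : G' g -> rho_pair [:: g; g] [:: g]
  | pair_L g : G5 g -> 2 <= height g ->
      rho_pair ([:: gc g] ++ gL g ++ [:: g]) [:: g]
  | pair_R g : G5 g -> 2 <= height g ->
      rho_pair ([:: g] ++ gR g ++ [:: gc g]) [:: g]
  | pair_c g : G5 g -> 2 <= height g ->
      rho_pair [:: gr g; Atom (gra g); g; Atom (ainv (gla g)); gl g]
               [:: gr g; Atom (gra g); gc g; Atom (ainv (gla g)); gl g].

(* The congruence on the semigroup G^+ generated by rho_pair. *)
Inductive rho : word -> word -> Prop :=
  | rho_gen u v : rho_pair u v -> rho u v
  | rho_refl u : Gplus u -> rho u u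
  | rho_sym u v : rho u v -> rho v u
  | rho_trans u v w : rho u v -> rho v w -> rho u w
  | rho_cat u v u' v' : rho u v -> rho u' v' -> rho (u ++ u') (v ++ v').

Definition rho_class (u : word) : word -> Prop := fun w => rho u w.

Definition left_anchored (g1 : symbol) (a : A) (g : symbol) : Prop :=
  [/\ G' g1, G5 g & (g1, a) = (gl g, gla g) \/ (g1, a) = (gr g, gra g)].

Definition right_anchored (g : symbol) (a : A) (g1 : symbol) : Prop :=
  [/\ G' g1, G5 g
    & (g1, a) = (gl g, ainv (gla g)) \/ (g1, a) = (gr g, ainv (gra g))].

Inductive landscape : word -> Prop :=
  | landscape_1 g : G' g -> landscape [:: g]
  | landscape_S g a h u :
      left_anchored g a h \/ right_anchored g a h ->
      landscape (h :: u) -> landscape [:: g, Atom a, h & u].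

(* u1 * u2, meaningful when the last letter of u1 is the first one of u2. *)
Definition glue (u1 u2 : word) : word := u1 ++ behead u2.

(* In [:: p; a; q; b; r], found in a landscape after the prefix s, the     *)
(* letter q is a river. The parity of size s ensures that p, q, r are      *)
(* letters g_{i-1}, g_i, g_{i+1} and a, b are letters a_i, a_{i+1}.        *)
Definition river (s : word) (p q r : symbol) : Prop :=
  [/\ ~~ odd (size s), height p = (height q).+1 & height r = (height q).+1].

Definition riverless (u : word) : Prop :=
  forall s p (a : A) q (b : A) r t,
    u = s ++ [:: p; Atom a; q; Atom b; r] ++ t -> ~ river s p q r.

Inductive uplift : word -> word -> Prop :=
  | uplift_del s p (a : A) q (b : A) r t :
      landscape (s ++ [:: p; Atom a; q; Atom b; r] ++ t) ->
      river s p q r ->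
      p = r /\ a = ainv b ->
      uplift (s ++ [:: p; Atom a; q; Atom b; r] ++ t) (s ++ [:: p] ++ t)
  | uplift_up s p (a : A) q (b : A) r t :
      landscape (s ++ [:: p; Atom a; q; Atom b; r] ++ t) ->
      river s p q r ->
      ~ (p = r /\ a = ainv b) ->
      uplift (s ++ [:: p; Atom a; q; Atom b; r] ++ t)
             (s ++ [:: p; Atom a; Tup r (ainv b) q a p; Atom b; r] ++ t).

(* The landscape without rivers reached from u by uplifting; it exists and *)
(* is unique when u is a landscape.                                        *)
Definition beta2 (u : word) : word :=
  epsilon (inhabits u)
    (fun v => [/\ landscape v, riverless v & clos_refl_trans _ uplift u v]).

(* In lamL and lamR the second case is g_{xx'}, the only element of G^5    *)
(* whose first component is an atom.                                       *)
Fixpoint lamL (g : symbol) : word :=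
  match g with
  | Atom _ => [:: Atom A1]
  | Tup (Atom _) _ _ _ _ => [:: Atom A1; Atom A1; gxx']
  | Tup l la c _ _ => lamL c ++ [:: Atom (ainv la); l; Atom la; g]
  end.

Fixpoint lamR (g : symbol) : word :=
  match g with
  | Atom _ => [:: Atom A1]
  | Tup (Atom _) _ _ _ _ => [:: gxx'; Atom A1; Atom A1]
  | Tup _ _ c ra r => [:: g; Atom (ainv ra); r; Atom ra] ++ lamR c
  end.

Definition beta1_letter (h : symbol) : word :=
  match h with
  | Atom Ax => [:: Atom A1; Atom A1; gxx'; Atom Ax; Atom A1]
  | Atom Ax' => [:: Atom A1; Atom Ax'; gxx'; Atom A1; Atom A1]
  | _ => glue (lamL h) (lamR h)
  end.

Definition beta1 (u : word) : word :=
  foldr (fun h w => glue (beta1_letter h) w) [::] u.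

Definition beta (u : word) : word := beta2 (beta1 u).

(* Main.v *)
From Stdlib Require Import Relation_Operators Operators_Properties ClassicalEpsilon.
From Stdlib Require Import FunctionalExtensionality PropExtensionality.
Require Import Defs.
From mathcomp Require Import all_boot.

(** Read a symbol g of positive height as a vertex with two downward edges,
    one to g^l labelled g^la and one to g^r labelled g^ra; traversed in the
    opposite direction an edge carries the inverse label.  Landscapes are then
    the walks in this graph, and the tuple (r, b', q, a, p) is exactly the new
    peak that fills a valley p a q b r which does not retrace its own edge
    ([lift_G5]).

    Uplifting is a rewriting system in which two rivers never share an edge,
    so that distinct steps commute ([up_diamond]); together with the existence
    of a riverless reduct ([riverless_exists]) this makes [beta2] an invariant
    of the equivalence [sim] generated by uplifting ([beta2_sim]).

    Congruent words have the same mountain.  The range of a landscape w from p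
    to q, read as a mere word, is equivalent to the walk that climbs to p by
    [lamL p], follows w, and descends by [lamR q] ([sim_beta1]): descending
    from p, crossing the range of the letter a and climbing to the next vertex
    q amounts to crossing the edge between them ([sim_edge], by induction on
    the upper vertex).  For the last three families of defining pairs both
    words are landscapes or single symbols, and this description turns the
    pairs into equalities or into one uplifting; g g versus g is
    [sim_collapse], and the remaining pairs are small computations.

    Conversely, every word u is congruent to its mountain ([rho_beta]).  It is
    congruent to its range because the first two kinds of pairs attached to g
    rebuild [lamL g] and [lamR g] from g.  An uplifting that replaces a river
    is literally one of the pairs; an uplifting that deletes one replaces
    p b' q b p by p, and both g g^L g and g g^R g are congruent to g, being
    congruent to g g^R g^c g^L g with g^c idempotent ([rho_loop_high]).  Hence
    equality of the mountains forces congruence. *)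

Set Implicit Arguments.
Unset Strict Implicit.
Unset Printing Implicit Defensive.

(** * The graph spanned by the anchorings *)

Lemma ainvK a : ainv (ainv a) = a.
Proof. by case: a. Qed.

(** The downward edges of g, each with the label read when climbing it. *)
Definition slot (g q : symbol) (a : A) : Prop :=
  (q, a) = (gl g, gla g) \/ (q, a) = (gr g, gra g).

Definition edge (p : symbol) (a : A) (q : symbol) : Prop :=
  left_anchored p a q \/ right_anchored p a q.

Lemma slotV g q a :
  (q, a) = (gl g, ainv (gla g)) \/ (q, a) = (gr g, ainv (gra g)) ->
  slot g q (ainv a).
Proof.
by case=> -[-> ->]; rewrite ainvK; [left | right].
Qed.

Lemma slot_edge_up g q a : G5 g -> G' q -> slot g q a -> edge q a g.
Proof. by move=> Gg Gq sg; left. Qed.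

Lemma slot_edge_down g q a : G5 g -> G' q -> slot g q a -> edge g (ainv a) q.
Proof.
by move=> Gg Gq sg; right; split=> //; case: sg => -[-> ->]; [left | right].
Qed.

Lemma G'1 : G' A1. Proof. by right. Qed.

Lemma G5x : G5 gxx'.
Proof. by exists 1 => //; exact: inGi_e inGe_1. Qed.

Lemma G5_gt0 g : G5 g -> 0 < height g.
Proof. by case=> i i0 /heightE ->. Qed.

(** Equal ends force a symbol to lie in some G_{i,e}, where the two labels
    always differ: the two downward edges of a vertex are distinct. *)
Lemma inGe_bigon i g : inGe i g -> gl g = gr g /\ gla g <> gra g.
Proof.
elim=> [//|j h _ [_ ne]|j h _ [_ ne]] /=; split=> // /(congr1 ainv);
  by rewrite !ainvK // => /esym.
Qed.

Lemma inGi_bigon i g : inGi i g -> inGe i g \/ gl g <> gr g.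
Proof. by case=> [? ? ?|*]; [left | right]. Qed.

Lemma inGi1 g : inGi 1 g -> g = gxx'.
Proof.
move=> Gg; inversion Gg as [i h eh|]; subst.
inversion eh as [|i h e0|i h e0] => //; by inversion e0.
Qed.

Lemma inGi0 g : ~ inGi 0 g.
Proof. by move=> Gg; inversion Gg as [i h eh|]; inversion eh. Qed.

Lemma inGi_G' i g : inGi i g -> G' g.
Proof. by case: i => [/inGi0 //|i Gg]; left; exists i.+1. Qed.

(** The uniform shape of the symbols of height at least 2, whichever of the two
    recursive clauses produced them: the centre c is a lower neighbour of both
    ends, along edges whose labels are recorded by the tuple, and the path
    l, c, r does not retrace an edge. *)
Variant high_spec : nat -> symbol -> Prop :=
  High i l la c ra r of inGi i.+1 l & inGi i.+1 r & G' c
     & slot l c (ainv la) & slot r c (ainv ra) & ~ (l = r /\ la = ra) :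
  high_spec i.+2 (Tup l la c ra r).

Lemma inGi_high i g : inGi i.+2 g -> high_spec i.+2 g.
Proof.
have slotG j h : inGe j.+1 h -> G' (gl h).
  elim: j h => [|j IH] h eh; inversion eh as [|k h' eh'|k h' eh']; subst=> /=;
    by [right | exact: inGi_G' (inGi_e eh') | inversion eh'].
move=> Gg; inversion Gg as [j h eg|j l la c ra r Gl Gc Gr ne sl sr]; subst.
  inversion eg as [|j h eh|j h eh]; subst; have [eqlr nea] := inGe_bigon eh;
    have Gh := inGi_e eh; split=> //.
  - exact: slotG eh.
  - by rewrite ainvK; left.
  - by rewrite ainvK; right; rewrite eqlr.
  - by case=> _ /(congr1 ainv); rewrite !ainvK.
  - exact: slotG eh.
  - by rewrite ainvK; right; rewrite eqlr.
  - by rewrite ainvK; left.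
  - by case=> _ /(congr1 ainv); rewrite !ainvK => /esym.
split=> //; try exact: slotV; first exact: inGi_G' Gc.
by case.
Qed.

(** Induction through both ends and the centre, with the geometry of
    [high_spec] at hand. *)
Lemma G'_ind (P : symbol -> Prop) :
  P A1 -> P gxx' ->
  (forall l la c ra r, G5 (Tup l la c ra r) -> 1 < height (Tup l la c ra r) ->
     G5 l -> G5 r -> G' c ->
     slot l c (ainv la) -> slot r c (ainv ra) -> ~ (l = r /\ la = ra) ->
     P l -> P c -> P r -> P (Tup l la c ra r)) ->
  forall g, G' g -> P g.
Proof.
move=> P1 Px PS g; elim: g => [a|l IHl la c IHc ra r IHr] [].
- by case=> -[|[|i]] // _ => [/inGi1 //|/inGi_high E]; inversion E.
- by move=> ->.
- move=> G5g; have := G5g; case=> -[|[|i]] // _ => [/inGi1 ->//|Gi].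
  have Hi := inGi_high Gi; inversion Hi as [? ? ? ? ? ? Gl Gr Gc sl sr ne]; subst.
  have Gl5: G5 l by exists i.+1.
  have Gr5: G5 r by exists i.+1.
  by apply: PS => //; [rewrite (heightE Gi) | apply: IHl; left | apply: IHc
    | apply: IHr; left].
- by [].
Qed.

Lemma slotG g q a : G5 g -> slot g q a -> G' q /\ height g = (height q).+1.
Proof.
case=> -[|[|i]] // _ => [/inGi1 ->|Gi sg].
  by case=> -[-> _]; split=> //; right.
rewrite (heightE Gi).
have Hi := inGi_high Gi; inversion Hi as [? ? ? ? ? ? Gl Gr _ _ _ _]; subst.
by case: sg => -[-> _] /=; [rewrite (heightE Gl) | rewrite (heightE Gr)];
  split=> //; left; exists i.+1.
Qed.

Lemma edgeG p a q : edge p a q -> G' p /\ G' q.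
Proof.
by case=> -[? ? _]; split=> //; left.
Qed.

Lemma succ_neq n : n <> n.+2.
Proof. by elim: n => // n IH [/IH]. Qed.

Lemma edge_down p a q :
  edge p a q -> height p = (height q).+1 -> G5 p /\ slot p q (ainv a).
Proof.
case=> -[Gl G5g sg] h; last by split=> //; exact: slotV.
by case: (slotG G5g sg) => _; rewrite h => /succ_neq.
Qed.

Lemma edge_up p a q :
  edge p a q -> height q = (height p).+1 -> G5 q /\ slot q p a.
Proof.
case=> -[Gl G5g sg] h //.
by case: (slotG G5g (slotV sg)) => _; rewrite h => /succ_neq.
Qed.

(** The tuple filling a valley lies in some G_{i,d} when the two sides differ.
    When they are the same vertex p, its two downward edges both end in q, so
    p is in some G_{i,e} and the tuple comes from p by one of the two clauses
    defining G_{i+1,e}. *)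
Lemma lift_G5 p a q b r :
  edge p a q -> edge q b r ->
  height p = (height q).+1 -> height r = (height q).+1 ->
  ~ (p = r /\ a = ainv b) ->
  G5 (Tup r (ainv b) q a p) /\ 1 < height (Tup r (ainv b) q a p).
Proof.
move=> Epq Eqr hp hr ne; split; last by rewrite /= hr.
have [Gp sp] := edge_down Epq hp; have [Gr sr] := edge_up Eqr hr.
have [i _ Gi] := Gp; have [j _ Gj] := Gr.
have ei := heightE Gi; have ej := heightE Gj.
have eji : j = i by rewrite -ei -ej hp hr.
rewrite eji in Gj ej.
have [epr|npr] := classic (p = r).
  subst r; exists i.+1 => //; apply: inGi_e.
  have neb : b <> ainv a by move=> e; apply: ne; rewrite e ainvK.
  have ep : inGe i p.
    case: (inGi_bigon Gi) => // nlr.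
    by case: sp sr => -[e0 e1] -[] [e2 e3]; try (by case: nlr; rewrite -e0 -e2);
      case: neb; rewrite e1 e3.
  have [elr _] := inGe_bigon ep.
  case: sp sr => -[e0 e1] -[] [e2 e3]; try by case: neb; rewrite e1 e3.
    by rewrite -[a]ainvK e0 e1 e3; exact: inGe_Sr.
  by rewrite -[a]ainvK e0 e1 e3 -elr; exact: inGe_Sl.
have [[k k1 Gq]|q1] := (edgeG Epq).2; last first.
  move: hp hr; rewrite q1 ei /= => i1 _; rewrite i1 in Gi Gj.
  by case: npr; rewrite (inGi1 Gi) (inGi1 Gj).
have ek := heightE Gq; rewrite ei ek in hp; rewrite hp in Gi Gj.
case: k k1 Gq Gi Gj {ek hp} => // k _ Gq Gi Gj.
exists k.+3 => //; apply: inGi_d => //; first by move/esym.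
  by case: sr => -[-> ->]; [left | right].
by case: sp => -[-> e]; rewrite -[a]ainvK e; [left | right].
Qed.

Lemma lift_edges p a q b r (h := Tup r (ainv b) q a p) :
  G5 h -> G' p -> G' r -> edge p a h /\ edge h b r.
Proof.
move=> Gh Gp Gr; split; first by left; split=> //; right.
by right; split=> //; left; rewrite /= ainvK.
Qed.

(** * Landscapes as routes *)

(** Landscapes with both endpoints named, so that gluing composes them. *)
Inductive route : symbol -> word -> symbol -> Prop :=
  | route1 p : G' p -> route p [:: p] p
  | routeS p a q w r : edge p a q -> route q w r ->
      route p [:: p, Atom a & w] r.

Lemma route_cons p w q : route p w q -> exists w', w = p :: w'.
Proof. by case=> [p' _|p' a q' w' r _ _]; eexists. Qed.

Lemma route_ends p w q : route p w q -> G' p /\ G' q.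
Proof. by elim=> // p' a q' w' r /edgeG[Gp _] _ [_ Gr]. Qed.

Lemma route_landscape p w q : route p w q -> landscape w.
Proof.
elim=> [p' Gp|p' a q' w' r E Rq IH]; first exact: landscape_1.
by case/route_cons: Rq IH => w'' ->; exact: landscape_S.
Qed.

Lemma route_nil p w q : route p w q -> w <> [::].
Proof. by case/route_cons=> w' ->. Qed.

Lemma route_glue p u q v r :
  route p u q -> route q v r -> route p (glue u v) r.
Proof.
elim=> [p' _ R|p' a q' w' r' E _ IH R]; last exact: routeS E (IH R).
by have [w' e] := route_cons R; rewrite e in R *.
Qed.

Lemma G'_G g : G' g -> G g.
Proof. by case=> [Gg|->]; [left | right; exists A1]. Qed.

Lemma route_Forall p w q : route p w q -> List.Forall G w.
Proof.
elim=> [p' Gp|p' a q' w' r' E _ IH].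
  by constructor=> //; exact: G'_G.
constructor; first by apply: G'_G; case: (edgeG E).
by constructor=> //; right; exists a.
Qed.

Lemma Forall_cat s t :
  List.Forall G (s ++ t) -> List.Forall G s /\ List.Forall G t.
Proof. by move=> H; apply/(List.Forall_app G s t). Qed.

Lemma route_Gplus p w q : route p w q -> Gplus w.
Proof. by move=> R; split; [exact: route_nil R | exact: route_Forall R]. Qed.

Lemma Gplus_cat u v : Gplus u -> Gplus v -> Gplus (u ++ v).
Proof.
case=> nu Gu [_ Gv]; split; first by case: u nu {Gu}.
by apply/List.Forall_app.
Qed.

Lemma Gplus1 g : G g -> Gplus [:: g].
Proof. by move=> Gg; split=> //; constructor. Qed.

Lemma Gplus_cons g u : G g -> Gplus u -> Gplus (g :: u).
Proof. by move=> Gg; apply: (@Gplus_cat [:: g]); exact: Gplus1. Qed.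

Lemma GA (a : A) : G a.
Proof. by right; exists a. Qed.

Lemma Gxx' : G gxx'.
Proof. by left; exact: G5x. Qed.

(** * Uplifting has unique normal forms *)

(** Uplifting without the requirement that the word be a landscape.  It is then
    closed under extension on both sides, which is what the congruence
    arguments need; stepping over two letters at a time keeps the redexes at
    vertex positions. *)
Inductive up : word -> word -> Prop :=
  | up_del p q b t : height p = (height q).+1 ->
      up [:: p, Atom (ainv b), q, Atom b, p & t] (p :: t)
  | up_lift p a q b r t :
      height p = (height q).+1 -> height r = (height q).+1 ->
      ~ (p = r /\ a = ainv b) ->
      up [:: p, Atom a, q, Atom b, r & t]
         [:: p, Atom a, Tup r (ainv b) q a p, Atom b, r & t]
  | up_next x y u v : up u v -> up [:: x, y & u] [:: x, y & v].

Lemma up_delV p a q t : height p = (height q).+1 ->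
  up [:: p, Atom a, q, Atom (ainv a), p & t] (p :: t).
Proof. by move=> h; rewrite -{1}[a]ainvK; exact: up_del. Qed.

Lemma up_pre s u v : ~~ odd (size s) -> up u v -> up (s ++ u) (s ++ v).
Proof.
have [n] := ubnP (size s); elim: n s => // n IH [|x [|y s]] //= lt.
rewrite negbK => es uv; apply: up_next; apply: IH es uv.
exact: ltnW.
Qed.

Lemma up_cat t u v : up u v -> up (u ++ t) (v ++ t).
Proof.
by elim=> [p q b s h|p a q b r s h h' ne|x y u' v' _ IH] /=; constructor.
Qed.

Lemma up_of_uplift u v : uplift u v -> up u v.
Proof.
case=> s p a q b r t _ [es hp hr] e; apply: up_pre => //=.
  by case: e => -> ->; apply: up_del; rewrite -?hr.
exact: up_lift.
Qed.

Lemma uplift_next x a u v :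
  landscape [:: x, Atom a & u] -> uplift u v ->
  uplift [:: x, Atom a & u] [:: x, Atom a & v].
Proof.
move=> Lu uv; case: uv Lu => s p a' q b r t _ [es hp hr] e Lu.
  by apply: (@uplift_del [:: x, Atom a & s] p a' q b r t) => //;
    split; rewrite //= negbK.
by apply: (@uplift_up [:: x, Atom a & s] p a' q b r t) => //;
  split; rewrite //= negbK.
Qed.

Lemma uplift_of_up u v : landscape u -> up u v -> uplift u v.
Proof.
move=> Lu uv; elim: uv Lu => [p q b t h|p a q b r t h h' ne|x y u' v' uv IH] Lu.
- by apply: (@uplift_del [::] p (ainv b) q b p t).
- by apply: (@uplift_up [::] p a q b r t).
inversion Lu as [|g a h w E Lw]; subst.
exact: uplift_next (IH Lw).
Qed.

Lemma up_head u v : up u v -> exists x u' v', u = x :: u' /\ v = x :: v'.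
Proof. by case=> *; do 3 eexists. Qed.

Lemma up_behead x u v : up (x :: u) v -> exists v', v = x :: v'.
Proof. by move=> /up_head[y [u' [v' [[-> _] ->]]]]; exists v'. Qed.

(** Two rivers are never neighbours among the vertices, since each is lower than
    the vertices next to it.  Hence two redexes share at most a bank, and a
    bank survives every step; distinct steps therefore commute in one step
    each. *)
Lemma up_diamond u v1 v2 :
  up u v1 -> up u v2 -> v1 = v2 \/ exists2 w, up v1 w & up v2 w.
Proof.
(* a step behind a river on q leaves the opposite bank r in place *)
have next_here q b r t v : up [:: q, Atom b, r & t] v ->
    height r = (height q).+1 -> exists2 v', v = [:: q, Atom b, r & v'] &
    up (r :: t) (r :: v').
  move=> U hr; inversion U as [p' q' b' t' h|p' a' q' b' r' t' h h'|x y u' v' uv];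
    subst; try by [case: (@succ_neq (height q)); rewrite h hr -h
      | case: (@succ_neq (height q)); rewrite {1}h hr].
  by have [v'' e] := up_behead uv; subst v'; exists v''.
move=> uv1; elim: uv1 v2 => {u v1} [p q b t h|p a q b r t h h' ne|x y u v uv IH] v2 U.
- inversion U as [? ? ? ? h2|? ? ? ? ? ? h1 h2 ne|? ? ? v' uv]; subst.
  + by left.
  + by case: ne.
  + have [v'' e uv'] := next_here _ _ _ _ _ uv h; subst v'.
    by right; exists (p :: v'') => //; exact: up_del.
- inversion U as [? ? ? ? h2|? ? ? ? ? ? h1 h2 ne'|? ? ? v' uv]; subst.
  + by case: ne.
  + by left.
  + have [v'' e uv'] := next_here _ _ _ _ _ uv h'; subst v'; right.
    by eexists; [do 2 apply: up_next; exact: uv' | exact: up_lift].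
- inversion U as [? q b ? h|p a q b r t h h' ne|? ? ? v' uv']; subst.
  + have [v'' e uv'] := next_here _ _ _ _ _ uv h; subst v.
    by right; exists (x :: v'') => //; exact: up_del.
  + have [v'' e uv'] := next_here _ _ _ _ _ uv h'; subst v; right.
    by eexists; [exact: up_lift | do 2 apply: up_next; exact: uv'].
  + have [->|[w U1 U2]] := IH _ uv'; first by left.
    by right; eexists; apply: up_next; eassumption.
Qed.

Lemma up_route p u q v : route p u q -> up u v -> route p v q.
Proof.
move=> R uv; elim: uv p R => {u v} [p q' b t h|p a q' b r t h h' ne|x y u v uv IH] p0 R.
- inversion R as [|? ? ? ? ? E R1]; subst.
  inversion R1 as [|? ? ? ? ? E1 R2]; subst.
  by have [? [? _]] := route_cons R2; subst.
- inversion R as [|? ? ? ? ? E R1]; subst.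
  inversion R1 as [|? ? ? ? ? E1 R2]; subst.
  have [? [? _]] := route_cons R2; subst.
  have [Gh _] := lift_G5 E E1 h h' ne.
  have [E2 E3] := lift_edges Gh (edgeG E).1 (edgeG E1).2.
  exact: routeS E2 (routeS E3 R2).
- inversion R as [|? ? ? ? ? E R1]; subst.
  exact: routeS E (IH _ R1).
Qed.

Lemma riverless_next x y u : riverless [:: x, y & u] -> riverless u.
Proof.
move=> N s p a q b r t e [es hp hr].
apply: (N [:: x, y & s] p a q b r t); first by rewrite e.
by split=> //=; rewrite negbK.
Qed.

Lemma riverless_normal u v : up u v -> ~ riverless u.
Proof.
elim=> [p q b t h|p a q b r t h h' ne|x y u' v' _ IH /riverless_next //] N.
  by apply: (N [::] p (ainv b) q b p t).
by apply: (N [::] p a q b r t).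
Qed.

Lemma riverless_cons p a w :
  (forall q b r t, w = [:: q; Atom b; r] ++ t ->
     height p = (height q).+1 -> height r <> (height q).+1) ->
  riverless w -> riverless [:: p, Atom a & w].
Proof.
move=> N0 N [|x [|y s]] p' a' q b r t /=.
- by case=> <- _ e [_ hp hr]; apply: N0 e hp hr.
- by move=> _ [].
- case=> _ _ e [/=]; rewrite negbK => es hp hr.
  by apply: (N _ _ _ _ _ _ _ e).
Qed.

Definition ups : word -> word -> Prop := clos_refl_trans _ up.

Lemma ups_next x y u v : ups u v -> ups [:: x, y & u] [:: x, y & v].
Proof.
elim=> [u' v' uv|u'|u' v' w _ IH1 _ IH2]; first by apply: rt_step; exact: up_next.
  exact: rt_refl.
exact: rt_trans IH1 IH2.
Qed.

(** Prepending an edge to a riverless walk creates at most one river, at q.  If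
    it is lifted, the new peak is prepended to the shorter riverless walk that
    starts at r, which is the induction hypothesis; and p is below that peak,
    so no river appears in front. *)
Lemma riverless_extend p a w q r :
  edge p a q -> route q w r -> riverless w ->
  exists2 v, riverless (p :: v) & ups [:: p, Atom a & w] (p :: v).
Proof.
move=> E R; elim: R p a E => {q w r} [q Gq|q b r w r' E1 R1 IH] p a E N.
  exists [:: Atom a; q]; last exact: rt_refl.
  by apply: riverless_cons.
have [w' e] := route_cons R1; subst w.
have [[hp hr]|nh] := classic (height p = (height q).+1 /\ height r = (height q).+1);
  last first.
  exists [:: Atom a, q, Atom b, r & w']; last exact: rt_refl.
  by apply: riverless_cons => // q0 b0 r0 t [<- _ <- _] h1 h2; apply: nh.
have Nw := riverless_next N.
have [[e1 e2]|ne] := classic (p = r /\ a = ainv b).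
  subst p a; exists w' => //.
  by apply: rt_step; exact: up_del.
have [Gh _] := lift_G5 E E1 hp hr ne.
have [E2 E3] := lift_edges Gh (edgeG E).1 (edgeG E1).2.
have [v Nv Uv] := IH _ _ E3 Nw.
exists [:: Atom a, Tup r (ainv b) q a p & v]; last first.
  apply: rt_trans (ups_next p (Atom a) Uv).
  by apply: rt_step; exact: up_lift.
apply: riverless_cons => // q0 b0 r0 t [<- _] /=; rewrite hr hp.
by move/succ_neq.
Qed.

Lemma riverless_exists p u q : route p u q -> exists2 v, riverless v & ups u v.
Proof.
elim=> {p u q} [p Gp|p a q w r E R [v Nv Uv]].
  by exists [:: p]; [case=> [|? []] | exact: rt_refl].
have Rv : route q v r.
  elim: Uv R => [u' v' uv R|//|u1 u2 u3 _ IH1 _ IH2 /IH1/IH2 //].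
  exact: up_route R uv.
have [v' Nv' Uv'] := riverless_extend E Rv Nv.
by exists (p :: v') => //; apply: rt_trans (ups_next _ _ Uv) Uv'.
Qed.

(** * The equivalence generated by uplifting *)

Definition sim : word -> word -> Prop := clos_refl_sym_trans _ up.

Lemma simT v u w : sim u v -> sim v w -> sim u w.
Proof. exact: rst_trans. Qed.

Lemma sim_map (f : word -> word) u v :
  (forall u v, up u v -> up (f u) (f v)) -> sim u v -> sim (f u) (f v).
Proof.
move=> Hf; elim=> {u v} [u v uv|u|u v _ IH|u v w _ IH1 _ IH2].
- by apply: rst_step; exact: Hf.
- exact: rst_refl.
- exact: rst_sym.
- exact: rst_trans IH1 IH2.
Qed.

Lemma sim_pre s u v : ~~ odd (size s) -> sim u v -> sim (s ++ u) (s ++ v).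
Proof. by move=> es; apply: (sim_map (f := cat s)) => u' v'; exact: up_pre. Qed.

Lemma sim_cat t u v : sim u v -> sim (u ++ t) (v ++ t).
Proof. by apply: (sim_map (f := cat^~ t)) => u' v'; exact: up_cat. Qed.

Lemma sim_glue p s q u v r :
  route p s q -> route q u r -> route q v r -> sim u v ->
  sim (glue s u) (glue s v).
Proof.
elim=> [q' _ Ru Rv|p' a q' w s' _ _ IH Ru Rv uv].
  by have [u' ->] := route_cons Ru; have [v' ->] := route_cons Rv.
exact: (@sim_pre [:: p'; Atom a] _ _ _ (IH Ru Rv uv)).
Qed.

(** The usual consequence of commuting steps: no step loses a reachable normal
    form. *)
Lemma ups_step u v n : up u v -> riverless n -> ups u n -> ups v n.
Proof.
move=> uv Nn /(clos_rt_rt1n _ _ _ _) un.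
elim: un Nn v uv => {u n} [n Nn v /riverless_normal //|u u1 n uu1 u1n IH Nn v uv].
have [<-|[w U1 U2]] := up_diamond uu1 uv; first exact: clos_rt1n_rt.
by apply: rt_trans (IH Nn _ U1); exact: rt_step.
Qed.

Lemma sim_normal u v n : riverless n -> sim u v -> ups u n <-> ups v n.
Proof.
move=> Nn; elim=> {u v} [u v uv|u|u v _ IH|u v w _ IH1 _ IH2] //.
- by split; [exact: ups_step | apply: rt_trans; exact: rt_step].
- by rewrite IH.
- by rewrite IH1.
Qed.

Lemma ups_uplift p u q v :
  route p u q -> ups u v -> route p v q /\ clos_refl_trans _ uplift u v.
Proof.
move=> R uv; elim: uv R => {u v} [u v uv|u|u v w _ IH1 _ IH2] R.
- split; first exact: up_route R uv.
  by apply: rt_step; apply: uplift_of_up uv; exact: route_landscape R.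
- by split=> //; exact: rt_refl.
- have [Rv uv] := IH1 R; have [Rw vw] := IH2 Rv.
  by split=> //; exact: rt_trans uv vw.
Qed.

(** The specification by which [beta2] was chosen is met on landscapes, because
    a riverless reduct exists. *)
Lemma beta2P p u q :
  route p u q -> [/\ route p (beta2 u) q, riverless (beta2 u) & ups u (beta2 u)].
Proof.
move=> R; have [v Nv Uv] := riverless_exists R.
have [Rv uv] := ups_uplift R Uv.
pose P v := [/\ landscape v, riverless v & clos_refl_trans _ uplift u v].
have [_ N U] : P (beta2 u).
  apply: (epsilon_spec (inhabits u) P); exists v; split=> //.
  exact: route_landscape Rv.
have U' : ups u (beta2 u).
  elim: U => [u' v' uv'|u'|u' v' w _ IH1 _ IH2].
  - by apply: rt_step; exact: up_of_uplift.
  - exact: rt_refl.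
  - exact: rt_trans IH1 IH2.
by split=> //; exact: (ups_uplift R U').1.
Qed.

Lemma ups_riverless u v : riverless u -> ups u v -> u = v.
Proof.
move=> Nu /(clos_rt_rt1n _ _ _ _) uv; case: uv Nu => // u' v' /riverless_normal N _.
by move/N.
Qed.

Lemma beta2_sim p u q p' v q' :
  route p u q -> route p' v q' -> sim u v -> beta2 u = beta2 v.
Proof.
move=> /beta2P[_ Nu Uu] /beta2P[_ Nv Uv] uv.
have /(sim_normal Nu (rst_sym _ _ _ _ uv)) Uu' := Uu.
apply/esym/ups_riverless => //.
have s : sim v (beta2 v).
  by elim: Uv => *; [apply: rst_step | exact: rst_refl | apply: rst_trans; eassumption].
by apply/(sim_normal Nu s)/(sim_normal Nu uv).
Qed.

(** * The mountain ranges of words *)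

Lemma glueA u v w : v <> [::] -> glue (glue u v) w = glue u (glue v w).
Proof. by case: v => // x v _; rewrite /glue /= -catA. Qed.

Lemma lamE l la c ra r : G5 l ->
  lamL (Tup l la c ra r) = lamL c ++ [:: Atom (ainv la); l; Atom la; Tup l la c ra r] /\
  lamR (Tup l la c ra r) =
    [:: Tup l la c ra r; Atom (ainv ra); r; Atom ra] ++ lamR c.
Proof. by case: l => // a /G5_gt0. Qed.

Lemma lamL_high g : G5 g -> 2 <= height g ->
  lamL g = lamL (gc g) ++ gL g ++ [:: g].
Proof.
move=> Gg; have Gg' : G' g by left.
elim/G'_ind: g / Gg' Gg => // l la c ra r _ _ Gl _ _ _ _ _ _ _ _ _ _.
by case: (lamE la c ra r Gl).
Qed.

Lemma lamR_high g : G5 g -> 2 <= height g ->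
  lamR g = [:: g] ++ gR g ++ lamR (gc g).
Proof.
move=> Gg; have Gg' : G' g by left.
elim/G'_ind: g / Gg' Gg => // l la c ra r _ _ Gl _ _ _ _ _ _ _ _ _ _.
by case: (lamE la c ra r Gl).
Qed.

Lemma edge1 : [/\ edge A1 A1 gxx', edge gxx' A1 A1, edge A1 Ax' gxx'
  & edge gxx' Ax A1].
Proof.
have s1 : slot gxx' A1 A1 by left.
have s2 : slot gxx' A1 Ax' by right.
split; first exact: slot_edge_up G5x G'1 s1.
- exact: slot_edge_down G5x G'1 s1.
- exact: slot_edge_up G5x G'1 s2.
- exact: slot_edge_down G5x G'1 s2.
Qed.

Lemma route_lam g : G' g -> route A1 (lamL g) g /\ route g (lamR g) A1.
Proof.
have [E1 E2 E3 E4] := edge1; have R1 := route1 G'1.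
move=> Gg; elim/G'_ind: g / Gg => [||l la c ra r Gg _ Gl Gr Gc sl sr _ _ [RL RR] _]; first by [].
  by split; [apply: routeS E1 _; exact: route1 (or_introl G5x)
    | exact: routeS E2 R1].
have [-> ->] := lamE la c ra r Gl.
have Gl' : G' l by left.
have Gr' : G' r by left.
have Gg' : G' (Tup l la c ra r) by left.
split.
  apply: (@route_glue _ _ c [:: c; Atom (ainv la); l; Atom la; _]) => //.
  apply: routeS (slot_edge_up Gl Gc sl) (routeS _ (route1 Gg')).
  by apply: slot_edge_up => //; left.
apply: routeS (slot_edge_down Gg Gr' (or_intror erefl)) (routeS _ RR).
by rewrite -[ra]ainvK; exact: slot_edge_down.
Qed.

Lemma beta1_letter_G' g : G' g -> beta1_letter g = glue (lamL g) (lamR g).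
Proof. by case=> [/G5_gt0|->]; case: g => // -[]. Qed.

Lemma route_beta1_letter g : G g -> route A1 (beta1_letter g) A1.
Proof.
have GR h : G' h -> route A1 (beta1_letter h) A1.
  move=> Gh; rewrite beta1_letter_G' //.
  by have [RL RR] := route_lam Gh; exact: route_glue RL RR.
have [E1 E2 E3 E4] := edge1; have R1 := route1 G'1.
case=> [Gg|[[] ->]]; first by apply: GR; left.
- by apply: GR; right.
- exact: routeS E1 (routeS E4 R1).
- exact: routeS E3 (routeS E2 R1).
Qed.

Lemma beta1_cons h w : beta1 (h :: w) = glue (beta1_letter h) (beta1 w).
Proof. by []. Qed.

Lemma beta1G' g : G' g -> beta1 [:: g] = glue (lamL g) (lamR g).
Proof. by move=> Gg; rewrite beta1_cons beta1_letter_G' // /glue /= cats0. Qed.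

Lemma route_beta1 u : Gplus u -> route A1 (beta1 u) A1.
Proof.
case=> nu Gu; elim: u Gu nu => // h w IH Gu _; rewrite beta1_cons.
inversion Gu; subst; case: w IH {Gu} H2 => [|k w] IH Gw.
  by rewrite /glue cats0; exact: route_beta1_letter.
by apply: route_glue (IH Gw _); first exact: route_beta1_letter.
Qed.

Lemma beta1_cat u v : Gplus u -> Gplus v -> beta1 (u ++ v) = glue (beta1 u) (beta1 v).
Proof.
case=> nu Gu Gv; elim: u Gu nu => // h w IH Gu _; rewrite cat_cons !beta1_cons.
inversion Gu; subst; case: w IH {Gu} H2 => [|k w] IH Gw.
  by rewrite /glue /= cats0.
rewrite IH // glueA //; apply: route_nil (route_beta1 _); split=> //.
Qed.

(** The words occurring in the last three families of defining pairs are
    landscapes. *)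
Lemma center_routes g : G5 g -> 2 <= height g ->
  [/\ route (gc g) ([:: gc g] ++ gL g ++ [:: g]) g,
      route g ([:: g] ++ gR g ++ [:: gc g]) (gc g),
      route (gr g) [:: gr g; Atom (gra g); g; Atom (ainv (gla g)); gl g] (gl g) &
      route (gr g) [:: gr g; Atom (gra g); gc g; Atom (ainv (gla g)); gl g] (gl g)].
Proof.
move=> Gg; have Gg' : G' g by left.
elim/G'_ind: g / Gg' Gg => [||l la c ra r _ _ Gl Gr Gc sl sr ne _ _ _ Gg _] //.
set g := Tup _ _ _ _ _ in Gg *.
have Gl' : G' l by left.
have Gr' : G' r by left.
have Gg' : G' g by left.
have gsl : slot g l la by left.
have gsr : slot g r ra by right.
have Ecl := slot_edge_up Gl Gc sl.
have Ecr := slot_edge_up Gr Gc sr.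
have Erc := slot_edge_down Gr Gc sr; rewrite ainvK in Erc.
have Elg := slot_edge_up Gg Gl' gsl; have Egl := slot_edge_down Gg Gl' gsl.
have Erg := slot_edge_up Gg Gr' gsr; have Egr := slot_edge_down Gg Gr' gsr.
have [Rg Rc Rl] := And3 (route1 Gg') (route1 Gc) (route1 Gl').
split.
- exact: routeS Ecl (routeS Elg Rg).
- exact: routeS Egr (routeS Erc Rc).
- exact: routeS Erg (routeS Egl Rl).
- exact: routeS Erc (routeS Ecl Rl).
Qed.

(** Filling the valley g^r, g^c, g^l recreates g itself. *)
Lemma up_center g : G5 g -> 2 <= height g ->
  up [:: gr g; Atom (gra g); gc g; Atom (ainv (gla g)); gl g]
     [:: gr g; Atom (gra g); g; Atom (ainv (gla g)); gl g].
Proof.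
move=> Gg; have Gg' : G' g by left.
elim/G'_ind: g / Gg' Gg => [||l la c ra r _ _ Gl Gr Gc sl sr ne _ _ _ Gg _] //.
have := @up_lift r ra c (ainv la) l [::]; rewrite ainvK /=; apply.
- by case: (slotG Gr sr).
- by case: (slotG Gl sl).
- by case=> e1 e2; apply: ne.
Qed.

(** Only the upper vertex g matters for the induction.  Let c be its centre,
    with ends l and r.  One of [lamL g], [lamR g] passes through c and then
    along l or r; the induction hypothesis for the edge between c and that
    end replaces the rest of the walk by a single edge.  What remains is a walk
    around c, g and the ends, where filling the valley at c (if the two edges
    at c differ) and deleting retraced edges leaves the edge in question. *)
Lemma sim_edge p a q :
  edge p a q -> sim (glue (lamR p) (glue (beta1_letter a) (lamL q))) [:: p; Atom a; q].
Proof.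
suff H g : G' g -> G5 g -> forall q a, slot g q a ->
    sim (glue (lamR q) (glue (beta1_letter a) (lamL g))) [:: q; Atom a; g] /\
    sim (glue (lamR g) (glue (beta1_letter (ainv a)) (lamL q)))
        [:: g; Atom (ainv a); q].
  case=> -[G1 G2 s]; first exact: (H _ (or_introl G2) G2 _ _ s).1.
  by have := (H _ (or_introl G2) G2 _ _ (slotV s)).2; rewrite ainvK.
move=> Gg; elim/G'_ind: g / Gg
  => {p a q} [/G5_gt0||l la c ra r Gg hg Gl Gr Gc sl sr ne IHl _ IHr _ q a s].
- by [].
- move=> _ q a [] [-> ->]; split; try exact: rst_refl.
    by apply: rst_step; apply: (@up_next A1 Ax'); exact: (@up_del gxx' A1 A1 [::]).
  by apply: rst_step; exact: (@up_del gxx' A1 A1 [:: Atom Ax; Atom A1]).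
set g := Tup l la c ra r in Gg hg *.
have [eL eR] := lamE la c ra r Gl; rewrite -/g in eL eR.
have hl : height g = (height l).+1 by [].
have hr : height g = (height r).+1 by case: (@slotG g r ra Gg (or_intror erefl)).
have hlc : height l = (height c).+1 by case: (slotG Gl sl).
have hrc : height r = (height c).+1 by case: (slotG Gr sr).
have nL : lamL c <> [::] by have [/route_nil] := route_lam Gc.
have nb (b : A) : beta1_letter b <> [::].
  by apply: route_nil (route_beta1_letter _); right; exists b.
have nbg (b : A) w : glue (beta1_letter b) w <> [::].
  by case: (beta1_letter b) (nb b).
have catg (x y z : word) : y <> [::] -> glue x (y ++ z) = glue x y ++ z.
  by case: y => // ? y _; rewrite /glue /= catA.
have lift := up_center Gg hg.
have [sl1 sl2] := IHl Gl _ _ sl; have [sr1 sr2] := IHr Gr _ _ sr.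
rewrite !ainvK in sl2 sr2.
(* the edge to l upwards and downwards, then the edge to r *)
case: s => -[-> ->]; rewrite eL eR; split.
- rewrite (catg _ (lamL c)) // (catg (lamR l)) //.
  apply: simT (sim_cat _ sl2) _.
  by apply: rst_step; exact: (@up_delV l la c [:: Atom la; g]).
- apply: simT (@sim_pre [:: g; Atom (ainv ra); r; Atom ra] _ _ isT sl1) _.
  apply: simT (rst_step _ _ _ _ (up_next g (Atom (ainv ra)) lift)) _.
  by apply: rst_step; exact: (@up_del g r ra [:: Atom (ainv la); l]).
- rewrite (catg _ (lamL c)) // (catg (lamR r)) //.
  apply: simT (sim_cat _ sr2) _.
  apply: simT (rst_step _ _ _ _ (up_cat [:: Atom la; g] lift)) _.
  apply: rst_step; apply: (@up_next r (Atom ra)).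
  exact: (@up_del g l la [::]).
- apply: simT (@sim_pre [:: g; Atom (ainv ra); r; Atom ra] _ _ isT sr1) _.
  apply: rst_step; apply: (@up_next g (Atom (ainv ra))).
  exact: (@up_delV r ra c [::]).
Qed.

(** Consecutive letters p a q of the walk contribute [lamR p], the range of a
    and [lamL q], which [sim_edge] contracts to the edge itself; only the first
    ascent and the last descent survive. *)
Lemma sim_beta1 p w q :
  route p w q -> sim (beta1 w) (glue (lamL p) (glue w (lamR q))).
Proof.
elim=> {p w q} [p Gp|p a q w r E Rw IH].
  rewrite beta1_cons beta1_letter_G' // /glue /= cats0.
  by have [_ /route_cons[w' ->]] := route_lam Gp; exact: rst_refl.
have [Gp Gq] := edgeG E; have [Lp Rp] := route_lam Gp; have [Lq Rq] := route_lam Gq.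
have Ga : G a by right; exists a.
have Ra := route_beta1_letter Ga.
have [w' ew] := route_cons Rw; subst w.
have Rr := (route_lam (route_ends Rw).2).2.
have Gw : Gplus (q :: w') by split=> //; exact: route_Forall Rw.
rewrite beta1_cons (beta1_cons a) beta1_letter_G' // glueA; last exact: route_nil Rp.
have Rwr := route_glue Rw Rr.
apply: (sim_glue Lp (q := p) (r := A1)).
- by apply: route_glue Rp (route_glue Ra (route_beta1 Gw)).
- exact: route_glue (routeS E Rw) Rr.
have H := sim_glue Ra (route_beta1 Gw) (route_glue Lq Rwr) IH.
apply: simT (sim_glue Rp (route_glue Ra (route_beta1 Gw)) _ H) _.
  by apply: route_glue Ra _; exact: route_glue Lq Rwr.
rewrite -(@glueA _ (lamL q)); last exact: route_nil Lq.
rewrite -(@glueA (lamR p)); last exact: route_nil (route_glue Ra Lq).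
exact: sim_cat _ (sim_edge E).
Qed.

(** Descending from g to the ground and climbing back is trivial: inductively
    the part below the centre disappears, the valley at the centre is filled
    by g, and the two remaining valleys retrace their edges. *)
Lemma sim_collapse g : G' g -> sim (glue (lamR g) (lamL g)) [:: g].
Proof.
move=> Gg; elim/G'_ind: g / Gg => [||l la c ra r Gg hg Gl Gr Gc sl sr ne _ IH _].
- exact: rst_refl.
- by apply: rst_step; exact: (@up_del gxx' A1 A1 [::]).
have [-> ->] := lamE la c ra r Gl; set g := Tup _ _ _ _ _ in Gg hg *.
have hl : height g = (height l).+1 by [].
have hr : height g = (height r).+1 by case: (@slotG g r ra Gg (or_intror erefl)).
have nL : lamL c <> [::] by have [/route_nil] := route_lam Gc.
have -> : glue ([:: g; Atom (ainv ra); r; Atom ra] ++ lamR c)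
             (lamL c ++ [:: Atom (ainv la); l; Atom la; g]) =
          [:: g; Atom (ainv ra); r; Atom ra] ++
             glue (lamR c) (lamL c) ++ [:: Atom (ainv la); l; Atom la; g].
  by case: (lamL c) nL => [//|x y] _; rewrite /glue /= -!catA.
apply: simT (@sim_pre [:: g; Atom (ainv ra); r; Atom ra] _ _ isT (sim_cat _ IH)) _.
apply: simT (rst_step _ _ _ _ (up_next g (Atom (ainv ra))
  (up_cat [:: Atom la; g] (up_center Gg hg)))) _.
apply: simT (rst_step _ _ _ _
  (@up_del g r ra [:: Atom (ainv la); l; Atom la; g] hr)) _.
by apply: rst_step; exact: (@up_del g l la [::]).
Qed.

(** * The mountain is constant on congruence classes *)

Lemma rho_pair_sim u v :
  rho_pair u v -> [/\ Gplus u, Gplus v & sim (beta1 u) (beta1 v)].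
Proof.
have GG a b : Gplus [:: Atom a; Atom b].
  by apply: Gplus_cons (Gplus1 _); exact: GA.
have GGG (a b c : A) : Gplus [:: Atom a; Atom b; Atom c].
  by apply: Gplus_cons (GA _) (GG _ _).
case=> {u v} [|||g Gg|g Gg|g Gg|g Gg hg|g Gg hg|g Gg hg].
- split=> //; first exact: Gplus1 (GA _).
  apply: simT (rst_step _ _ _ _ (@up_next A1 A1 _ _ (@up_delV gxx' Ax A1
    [:: Atom A1; Atom A1; Atom A1; gxx'; Atom Ax; Atom A1] erefl))) _.
  apply: rst_step; apply: (@up_next A1 A1).
  exact: (@up_delV gxx' A1 A1 [:: Atom Ax; Atom A1]).
- split=> //; first exact: Gplus1 (GA _).
  apply: simT (rst_step _ _ _ _ (@up_next A1 Ax' _ _ (@up_delV gxx' A1 A1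
    [:: Atom Ax; Atom A1; Atom Ax'; gxx'; Atom A1; Atom A1] erefl))) _.
  apply: rst_step; apply: (@up_next A1 Ax').
  exact: (@up_delV gxx' Ax A1 [:: Atom A1; Atom A1]).
- split=> //; first exact: Gplus1 Gxx'.
  apply: rst_sym; apply: rst_step.
  exact: (@up_next A1 A1 _ _ (@up_del gxx' A1 Ax' [:: Atom A1; Atom A1] erefl)).
- split; try exact: Gplus1; first exact: Gplus_cons (GA _) (Gplus1 Gg).
  rewrite beta1_cons; have [w' ->] := route_cons (route_beta1 (Gplus1 Gg)).
  exact: rst_refl.
- split; try exact: Gplus1; first exact: Gplus_cons Gg (Gplus1 (GA _)).
  exact: rst_refl.
- have Gg1 := Gplus1 (G'_G Gg); have [RL RR] := route_lam Gg.
  split=> //; first exact: Gplus_cons (G'_G Gg) Gg1.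
  rewrite beta1_cons beta1G' // beta1_letter_G' //.
  rewrite glueA; last exact: route_nil RR.
  rewrite -(@glueA (lamR g)); last exact: route_nil RL.
  apply: (sim_glue RL _ RR _); first exact: route_glue (route_glue RR RL) RR.
  apply: simT (sim_cat _ (sim_collapse Gg)) _.
  by have [w ->] := route_cons RR; exact: rst_refl.
- have [R _ _ _] := center_routes Gg hg.
  split; [exact: route_Gplus R | exact: Gplus1 (or_introl Gg) |].
  apply: simT (sim_beta1 R) _.
  rewrite beta1G' ?(lamL_high Gg hg); last by left.
  by rewrite /glue /= -!catA; exact: rst_refl.
- have [_ R _ _] := center_routes Gg hg.
  split; [exact: route_Gplus R | exact: Gplus1 (or_introl Gg) |].
  apply: simT (sim_beta1 R) _.
  rewrite beta1G' ?(lamR_high Gg hg); last by left.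
  have [_ /route_cons[w ->]] := route_lam (route_ends R).2.
  exact: rst_refl.
- have [_ _ R1 R2] := center_routes Gg hg.
  split; [exact: route_Gplus R1 | exact: route_Gplus R2 |].
  apply: simT (sim_beta1 R1) (rst_sym _ _ _ _ (simT (sim_beta1 R2) _)).
  have [Gr Gl] := route_ends R1.
  have [Lr _] := route_lam Gr; have [_ Rl] := route_lam Gl.
  apply: (sim_glue Lr (route_glue R2 Rl) (route_glue R1 Rl)).
  exact: sim_cat _ (rst_step _ _ _ _ (up_center Gg hg)).
Qed.

Lemma rho_sim u v :
  rho u v -> [/\ Gplus u, Gplus v & sim (beta1 u) (beta1 v)].
Proof.
elim=> {u v} [u v /rho_pair_sim //|u Gu|u v _ [Gu Gv uv]|u v w _ [Gu _ uv] _ [_ Gw vw]|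
  u v u' v' _ [Gu Gv uv] _ [Gu' Gv' uv']].
- by split=> //; exact: rst_refl.
- by split=> //; exact: rst_sym.
- by split=> //; exact: simT uv vw.
split; try exact: Gplus_cat.
rewrite !beta1_cat //; have Ru := route_beta1 Gu.
apply: simT (sim_glue Ru (route_beta1 Gu') (route_beta1 Gv') uv') _.
exact: sim_cat.
Qed.

Lemma beta_rho u v : rho u v -> beta u = beta v.
Proof.
case/rho_sim=> Gu Gv uv.
exact: beta2_sim (route_beta1 Gu) (route_beta1 Gv) uv.
Qed.

(** * Every word is congruent to its mountain *)

Lemma rho_pre s u v : List.Forall G s -> rho u v -> rho (s ++ u) (s ++ v).
Proof.
by case: s => [|x s] // Gs; apply: rho_cat; exact: rho_refl.
Qed.

Lemma rho_suf t u v : List.Forall G t -> rho u v -> rho (u ++ t) (v ++ t).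
Proof.
case: t => [|x t] Gt uv; first by rewrite !cats0.
by apply: rho_cat uv _; exact: rho_refl.
Qed.

Lemma rho_1l u : Gplus u -> rho (Atom A1 :: u) u.
Proof.
case: u => [[] //|g u] [_ Gu]; inversion Gu as [|? ? Gg Gu']; subst.
exact: rho_suf Gu' (rho_gen (pair_1l Gg)).
Qed.

Lemma rho_1r g : G g -> rho [:: g; Atom A1] [:: g].
Proof. by move=> Gg; exact: rho_gen (pair_1r Gg). Qed.

Lemma rho_gxx' : rho [:: gxx'] [:: Atom Ax; Atom Ax'].
Proof. exact: rho_gen pair_gxx'. Qed.

Lemma rho_xx'x : rho [:: gxx'; Atom Ax] [:: Atom Ax].
Proof.
apply: rho_trans (rho_gen pair_x).
exact: (@rho_suf [:: Atom Ax]) (Gplus1 (GA _)).2 rho_gxx'.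
Qed.

Lemma rho_x'xx' : rho [:: Atom Ax'; gxx'] [:: Atom Ax'].
Proof.
apply: rho_trans (rho_gen pair_x').
exact: (@rho_pre [:: Atom Ax']) (Gplus1 (GA _)).2 rho_gxx'.
Qed.

Lemma rho_idem g : G' g -> rho [:: g; g] [:: g].
Proof. by move=> Gg; exact: rho_gen (pair_idem Gg). Qed.

(** Both words are congruent to g g^R g^c g^L g, which collapses from either
    side.  Doubling its idempotent centre g^c splits it into g g^R g^c and
    g^c g^L g, so that it is also congruent to g g, hence to g. *)
Lemma rho_loop_high g : G5 g -> 2 <= height g ->
  rho ([:: g] ++ gL g ++ [:: g]) [:: g] /\ rho ([:: g] ++ gR g ++ [:: g]) [:: g].
Proof.
move=> Gg hg; have Gg' : G' g by left.
have [R1 R2 _ _] := center_routes Gg hg.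
have Gc := (route_ends R1).1.
have FR : List.Forall G ([:: g] ++ gR g).
  by move/route_Forall: R2; rewrite catA => /Forall_cat[].
have FL : List.Forall G (gL g ++ [:: g]) by case/route_Forall/Forall_cat: R1.
have pL := rho_gen (pair_L Gg hg); have pR := rho_gen (pair_R Gg hg).
pose m := ([:: g] ++ gR g) ++ [:: gc g] ++ (gL g ++ [:: g]).
have mL : rho m ([:: g] ++ gL g ++ [:: g]).
  by have := rho_suf FL pR; rewrite /m /gL /gR.
have mR : rho m ([:: g] ++ gR g ++ [:: g]).
  by have := rho_pre FR pL; rewrite /m /gL /gR.
have mg : rho m [:: g].
  apply: rho_trans (rho_idem Gg').
  apply: rho_trans (rho_cat pR pL).
  have := rho_pre FR (rho_suf FL (rho_sym (rho_idem Gc))).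
  by rewrite /m /gL /gR.
by split; apply: rho_trans mg; exact: rho_sym.
Qed.

Lemma rho_loop p q b : G5 p -> slot p q b ->
  rho [:: p; Atom (ainv b); q; Atom b; p] [:: p].
Proof.
move=> Gp sp; have [hp|hp] := leqP 2 (height p).
  have [L R] := rho_loop_high Gp hp.
  by case: sp => -[-> ->].
have ep : p = gxx'.
  by case: Gp sp hp => i i1 Gi _; rewrite (heightE Gi); case: i i1 Gi => [|[|i]] // _ /inGi1.
subst p.
have pp := rho_idem (or_introl G5x).
case: sp => -[-> ->] /=.
  apply: rho_trans pp; apply: (@rho_pre [:: gxx'] _ [:: gxx'] (Gplus1 Gxx').2).
  do 2 (apply: rho_trans (rho_1l (Gplus1 Gxx'));
    apply: (@rho_pre [:: Atom A1]) (Gplus1 (GA _)).2 _).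
  exact: rho_1l (Gplus1 Gxx').
apply: rho_trans (rho_sym rho_gxx').
apply: (@rho_cat [:: gxx'; Atom Ax] [:: Atom Ax] [:: Atom A1; Atom Ax'; gxx'] [:: Atom Ax']).
  exact: rho_xx'x.
apply: rho_trans (rho_x'xx'); apply: rho_1l.
exact: Gplus_cons (GA _) (Gplus1 Gxx').
Qed.

(** A deleted river is a loop p b' q b p, and a lifted one is the last defining
    pair for the new peak, read backwards. *)
Lemma rho_up p u q v : route p u q -> up u v -> rho u v.
Proof.
move=> R uv; elim: uv p R => {u v} [p q' b t h|p a q' b r t h h' ne|x y u v uv IH] p0 R.
- have F := route_Forall R.
  inversion R as [|? ? ? ? ? E R1]; subst.
  inversion R1 as [|? ? ? ? ? E1 R2]; subst.
  have [Gp sp] := edge_down E h; rewrite ainvK in sp.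
  apply: (rho_suf (u := [:: p; Atom (ainv b); q'; Atom b; p]) (v := [:: p])) (rho_loop Gp sp).
  by case/(@Forall_cat [:: _; _; _; _; _] _): F.
- have F := route_Forall R.
  inversion R as [|? ? ? ? ? E R1]; subst.
  inversion R1 as [|? ? r' ? ? E1 R2]; subst.
  have [w [er _]] := route_cons R2; subst r'.
  have [Gh hh] := lift_G5 E E1 h h' ne.
  have := pair_c Gh hh; rewrite /= ainvK => /rho_gen/rho_sym H.
  apply: (rho_suf (u := [:: p; Atom a; q'; Atom b; r])) H.
  by case/(@Forall_cat [:: _; _; _; _; _] _): F.
- inversion R as [|? ? ? ? ? E R1]; subst.
  apply: (@rho_pre [:: x; Atom a]) (IH _ R1).
  by case/(@Forall_cat [:: _; _] _): (route_Forall R).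
Qed.

Lemma rho_ups p u q v : route p u q -> ups u v -> rho u v.
Proof.
move=> R uv; elim: uv R => {u v} [u v uv|u|u v w uv IH1 _ IH2] R.
- exact: rho_up R uv.
- exact: rho_refl (route_Gplus R).
- exact: rho_trans (IH1 R) (IH2 (ups_uplift R uv).1).
Qed.

Lemma rho_glue p s q t r : route p s q -> route q t r -> rho (s ++ t) (glue s t).
Proof.
move=> R; elim: R t => {p s q} [q Gq|p a q w s E _ IH] t Rt.
  have [t' et] := route_cons Rt; subst t.
  apply: (@rho_suf t' [:: q; q] [:: q]) (rho_idem Gq).
  by have [] := @Forall_cat [:: q] _ (route_Forall Rt).
apply: (@rho_pre [:: p; Atom a] (w ++ t) (glue w t)) (IH _ Rt).
by have [/G'_G Gp _] := edgeG E; constructor=> //; exact: (Gplus1 (GA a)).2.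
Qed.

(** The pair that absorbs g^c g^L into g unfolds one level of [lamL], and the
    pair that absorbs g^R g^c one level of [lamR]. *)
Lemma rho_lam g : G' g -> rho (lamL g) [:: g] /\ rho (lamR g) [:: g].
Proof.
move=> Gg; elim/G'_ind: g / Gg => [||l la c ra r Gg hg Gl Gr Gc sl sr ne _ [IHL IHR] _].
- by split; exact: rho_refl (Gplus1 (GA A1)).
- have Gx := Gplus1 Gxx'; split.
    apply: rho_trans (rho_1l Gx).
    exact: rho_1l (Gplus_cons (GA A1) Gx).
  apply: rho_trans (rho_1r Gxx').
  exact: (@rho_suf [:: Atom A1]) (Gplus1 (GA _)).2 (rho_1r Gxx').
have [R1 R2 _ _] := center_routes Gg hg.
rewrite lamL_high // lamR_high //; split.
  apply: rho_trans (rho_gen (pair_L Gg hg)).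
  by apply: rho_suf IHL; case/route_Forall/Forall_cat: R1.
apply: rho_trans (rho_gen (pair_R Gg hg)).
rewrite catA [X in rho _ X]catA; apply: rho_pre IHR.
by move/route_Forall: R2; rewrite catA => /Forall_cat[].
Qed.

Lemma rho_beta1_letter g : G g -> rho [:: g] (beta1_letter g).
Proof.
have G'case h : G' h -> rho [:: h] (beta1_letter h).
  move=> Gh; have [L R] := rho_lam Gh; have [RL RR] := route_lam Gh.
  rewrite beta1_letter_G' //; apply: rho_trans (rho_sym (rho_idem Gh)) _.
  apply: rho_trans (rho_glue RL RR).
  exact: (rho_cat (rho_sym L) (rho_sym R)).
have Gx := Gplus1 Gxx'.
case=> [Gg|[[] ->]]; first by apply: G'case; left.
- by apply: G'case; right.
- apply: rho_sym; apply: rho_trans rho_xx'x.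
  have H := @rho_pre [:: gxx'] _ _ Gx.2 (rho_1r (GA Ax)).
  have Gy := Gplus_cons Gxx' (Gplus_cons (GA Ax) (Gplus1 (GA A1))).
  apply: rho_trans H; apply: rho_trans (rho_1l Gy).
  exact: rho_1l (Gplus_cons (GA _) Gy).
- apply: rho_sym; apply: rho_trans rho_x'xx'.
  apply: rho_trans (rho_1l (Gplus_cons (GA Ax') Gx)).
  apply: (@rho_pre [:: Atom A1; Atom Ax'] [:: gxx'; Atom A1; Atom A1] [:: gxx']).
    by have [] := Gplus_cons (GA A1) (Gplus1 (GA Ax')).
  apply: rho_trans (rho_1r Gxx').
  exact: (@rho_suf [:: Atom A1]) (Gplus1 (GA _)).2 (rho_1r Gxx').
Qed.

Lemma rho_beta1 u : Gplus u -> rho u (beta1 u).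
Proof.
case=> nu Gu; elim: u Gu nu => // h w IH Gu _.
inversion Gu as [|? ? Gh Gw]; subst; rewrite beta1_cons.
case: w IH {Gu} Gw => [|k w] IH Gw.
  by rewrite /glue /= cats0; exact: rho_beta1_letter.
have Gkw : Gplus (k :: w) by [].
apply: rho_trans (rho_cat (rho_beta1_letter Gh) (IH Gw _)) _ => //.
exact: rho_glue (route_beta1_letter Gh) (route_beta1 Gkw).
Qed.

Lemma rho_beta u : Gplus u -> rho u (beta u).
Proof.
move=> Gu; have R := route_beta1 Gu; have [_ _ U] := beta2P R.
exact: rho_trans (rho_beta1 Gu) (rho_ups R U).
Qed.

Lemma beta_eq_rho u v : Gplus u -> Gplus v -> beta u = beta v <-> rho u v.
Proof.
move=> Gu Gv; split; last exact: beta_rho.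
move=> e; apply: rho_trans (rho_beta Gu) _; rewrite e.
exact: rho_sym (rho_beta Gv).
Qed.

Lemma rho_classE u v :
  Gplus u -> Gplus v -> rho_class u = rho_class v <-> rho u v.
Proof.
move=> Gu Gv; split=> [e|uv].
  by rewrite -/(rho_class u v) e; exact: rho_refl.
apply: functional_extensionality => w; apply: propositional_extensionality.
by split; apply: rho_trans; [exact: rho_sym|].
Qed.

Theorem proposition3p10 (g : symbol) (u v : word) :
  G5 g -> 2 <= height g -> Gplus u -> Gplus v ->
  [/\ beta [:: g] = beta ([:: gc g] ++ gL g ++ [:: g]),
      beta ([:: gc g] ++ gL g ++ [:: g]) = beta ([:: g] ++ gR g ++ [:: gc g])
    & beta [:: gr g; Atom (gra g); gc g; Atom (ainv (gla g)); gl g] =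
      beta [:: gr g; Atom (gra g); g; Atom (ainv (gla g)); gl g]] /\
  (beta u = beta v <-> rho_class u = rho_class v).
Proof.
move=> Gg hg Gu Gv; split; last by rewrite beta_eq_rho // rho_classE.
have eL := beta_rho (rho_gen (pair_L Gg hg)).
have eR := beta_rho (rho_gen (pair_R Gg hg)).
split; [by rewrite eL | by rewrite eL eR |].
exact/esym/beta_rho/rho_gen/pair_c.
Qed.
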